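(* Let $m\ge n\ge2$ be integers with $(m,n)\neq(2,2)$, let $G_{m,n}=\langle x,y \mid x^m=y^n\rangle$, and let $<_D$ be the Dehornoy-like ordering of $G_{m,n}$ defined by the ordered generating set $\mathcal{S}=\{s_1=xyx^{-m+1},\ s_2=x^{m-1}y^{-1}\}$. Then $<_D$ does not have Property $S$ unless $(m,n)=(3,2)$.
   Context: Dehornoy-like ordering: $<_D$ is the left ordering of $G_{m,n}$ (total order invariant under left multiplication) whose positive cone $\{g: 1<_D g\}$ is the set of elements represented either by a word on $s_1,s_2^{\pm1}$ containing at least one $s_1$ and no $s_1^{-1}$, or by $s_2^k$ with $k\ge1$. It is known that this set is indeed the positive cone of a left ordering. Property $S$ (Subword property) for the Dehornoy-like ordering $<_D$ defined by $\mathcal{S}$: $g<_D wg$ for every $g\in G_{m,n}$ and every $\mathcal{S}$-word positive element $w$, i.e. every $w$ represented by a nonempty word in $s_1,s_2$ without inverses. *)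

(* Defs.v *)
From HB Require Import structures.
From mathcomp Require Import all_boot.
From mathcomp Require Import boolp.

Set Implicit Arguments.
Unset Strict Implicit.
Unset Printing Implicit Defensive.

Local Open Scope group_scope.

(* Words over two generators and their formal inverses. The letter (i, e) is
   the first generator if i = false and the second one if i = true; it is
   inverted exactly when e = true. *)
Definition letter : Type := (bool * bool)%type.
Definition word : Type := seq letter.

Definition letterV (l : letter) : letter := (l.1, ~~ l.2).
Definition wordV (w : word) : word := rev (map letterV w).

Definition letter_val (G : groupType) (a b : G) (l : letter) : G :=
  let c := if l.1 then b else a in if l.2 then c^-1 else c.

Definition word_val (G : groupType) (a b : G) (w : word) : G :=
  \prod_(l <- w) letter_val a b l.

(* The least congruence on words that cancels l l^-1 for every letter l and
   identifies x^m with y^n, where x and y are the two generators. *)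
Inductive pres_eq (m n : nat) : word -> word -> Prop :=
| Pres_refl u : pres_eq m n u u
| Pres_sym u v : pres_eq m n u v -> pres_eq m n v u
| Pres_trans u v w : pres_eq m n u v -> pres_eq m n v w -> pres_eq m n u w
| Pres_cat u u' v v' :
    pres_eq m n u u' -> pres_eq m n v v' -> pres_eq m n (u ++ v) (u' ++ v')
| Pres_cancel l : pres_eq m n [:: l; letterV l] [::]
| Pres_rel : pres_eq m n (nseq m (false, false)) (nseq n (true, false)).

Section Group.
Variables m n : nat.

Definition pres_eqb : rel word := fun u v => `[< pres_eq m n u v >].

Lemma pres_eqb_refl : reflexive pres_eqb.
Proof. by move=> u; apply/asboolP; constructor. Qed.

Lemma pres_eqb_sym : symmetric pres_eqb.
Proof. by move=> u v; apply/asboolP/asboolP; apply: Pres_sym. Qed.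

Lemma pres_eqb_trans : transitive pres_eqb.
Proof.
by move=> v u w /asboolP uv /asboolP vw; apply/asboolP; apply: Pres_trans vw.
Qed.

Canonical pres_equiv := EquivRel pres_eqb pres_eqb_refl pres_eqb_sym pres_eqb_trans.

Local Open Scope quotient_scope.

(* The group G_{m,n} = < x, y | x^m = y^n >. *)
Definition Gmn : Type := {eq_quot pres_equiv}.

HB.instance Definition _ := Choice.on Gmn.

Definition Gmn_class (w : word) : Gmn := \pi_{eq_quot pres_equiv} w.

Lemma Gmn_classP u v : Gmn_class u = Gmn_class v <-> pres_eq m n u v.
Proof.
split; first by move/eqmodP/asboolP.
by move=> uv; apply/eqmodP/asboolP.
Qed.

Lemma Gmn_reprK g : Gmn_class (repr g) = g.
Proof. exact: reprK. Qed.

Lemma pres_eq_repr w : pres_eq m n (repr (Gmn_class w)) w.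
Proof. by apply/Gmn_classP; rewrite Gmn_reprK. Qed.

Lemma letterVK : involutive letterV.
Proof. by case=> i e; rewrite /letterV /= negbK. Qed.

Lemma wordV_cat u v : wordV (u ++ v) = wordV v ++ wordV u.
Proof. by rewrite /wordV map_cat rev_cat. Qed.

Lemma wordVK : involutive wordV.
Proof. by move=> w; rewrite /wordV map_rev revK (mapK letterVK). Qed.

Lemma pres_eq_mulV w : pres_eq m n (w ++ wordV w) [::].
Proof.
elim: w => [|l w IHw]; first exact: Pres_refl.
have ->: (l :: w) ++ wordV (l :: w) = [:: l] ++ (w ++ wordV w) ++ [:: letterV l].
  by rewrite -cat1s wordV_cat -!catA.
apply: Pres_trans (Pres_cancel m n l).
apply: (Pres_cat (Pres_refl _ _ [:: l])).
exact: (Pres_cat IHw (Pres_refl _ _ [:: letterV l])).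
Qed.

Lemma pres_eq_Vmul w : pres_eq m n (wordV w ++ w) [::].
Proof. by have := pres_eq_mulV (wordV w); rewrite wordVK. Qed.

Lemma pres_eq_wordV u v : pres_eq m n u v -> pres_eq m n (wordV u) (wordV v).
Proof.
move=> uv; apply: (@Pres_trans _ _ _ (wordV u ++ (v ++ wordV v))).
  rewrite -{1}[wordV u]cats0; apply: Pres_cat; first exact: Pres_refl.
  exact/Pres_sym/pres_eq_mulV.
rewrite catA -{2}[wordV v]cat0s; apply: Pres_cat; last exact: Pres_refl.
apply: Pres_trans (pres_eq_Vmul u).
by apply: Pres_cat; [exact: Pres_refl | exact: Pres_sym].
Qed.

Definition Gmn_one : Gmn := Gmn_class [::].
Definition Gmn_mul (g h : Gmn) : Gmn := Gmn_class (repr g ++ repr h).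
Definition Gmn_inv (g : Gmn) : Gmn := Gmn_class (wordV (repr g)).

Lemma Gmn_mul_class u v :
  Gmn_mul (Gmn_class u) (Gmn_class v) = Gmn_class (u ++ v).
Proof. by apply/Gmn_classP; apply: Pres_cat; apply: pres_eq_repr. Qed.

Lemma Gmn_inv_class u : Gmn_inv (Gmn_class u) = Gmn_class (wordV u).
Proof. by apply/Gmn_classP/pres_eq_wordV/pres_eq_repr. Qed.

Lemma Gmn_mulA : associative Gmn_mul.
Proof.
move=> g h k; rewrite -(Gmn_reprK g) -(Gmn_reprK h) -(Gmn_reprK k).
by rewrite !Gmn_mul_class catA.
Qed.

Lemma Gmn_mul1 : left_id Gmn_one Gmn_mul.
Proof. by move=> g; rewrite -(Gmn_reprK g) Gmn_mul_class. Qed.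

Lemma Gmn_mulr1 : right_id Gmn_one Gmn_mul.
Proof. by move=> g; rewrite -(Gmn_reprK g) Gmn_mul_class cats0. Qed.

Lemma Gmn_mulV : left_inverse Gmn_one Gmn_inv Gmn_mul.
Proof.
move=> g; rewrite -(Gmn_reprK g) Gmn_inv_class Gmn_mul_class.
exact/Gmn_classP/pres_eq_Vmul.
Qed.

Lemma Gmn_mulrV : right_inverse Gmn_one Gmn_inv Gmn_mul.
Proof.
move=> g; rewrite -(Gmn_reprK g) Gmn_inv_class Gmn_mul_class.
exact/Gmn_classP/pres_eq_mulV.
Qed.

HB.instance Definition _ :=
  isGroup.Build Gmn Gmn_mulA Gmn_mul1 Gmn_mulr1 Gmn_mulV Gmn_mulrV.

Definition gen_x : Gmn := Gmn_class [:: (false, false)].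
Definition gen_y : Gmn := Gmn_class [:: (true, false)].

Definition gen_s1 : Gmn := gen_x * gen_y * gen_x ^- (m - 1).
Definition gen_s2 : Gmn := gen_x ^+ (m - 1) * gen_y^-1.

(* Below, words are read in the letters s1 and s2 instead of x and y. *)
Definition dehornoy_cone (g : Gmn) : Prop :=
  (exists w : word,
      [/\ (false, false) \in w, (false, true) \notin w
        & g = word_val gen_s1 gen_s2 w])
  \/ (exists k : nat, (1 <= k)%N /\ g = gen_s2 ^+ k).

(* A left ordering is determined by its positive cone P: g < h iff g^-1 * h is
   in P. That dehornoy_cone is a positive cone is a fact about G_{m,n}, not part
   of this definition. *)
Definition dehornoy_lt (g h : Gmn) : Prop := dehornoy_cone (g^-1 * h).

Definition S_word_positive (w : Gmn) : Prop :=
  exists u : word,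
    [/\ u != [::], all (fun l : letter => ~~ l.2) u
      & w = word_val gen_s1 gen_s2 u].

Definition property_S (lt : Gmn -> Gmn -> Prop) : Prop :=
  forall g w : Gmn, S_word_positive w -> lt g (w * g).

End Group.

(* Main.v *)
Require Import Defs.
From mathcomp Require Import all_boot.
From mathcomp Require Import all_order all_algebra.
From mathcomp Require Import ring lra.

Set Implicit Arguments.
Unset Strict Implicit.
Unset Printing Implicit Defensive.

(** The idea is to let G_{m,n} act on an ordered line by order-preserving maps
    with a point p such that s2 p = p and p <= s1 p. A word in s1 and s2^{+-1}
    without s1^{-1} then never moves p below itself, so every g in the Dehornoy
    cone satisfies p <= g p ([dehornoy_cone_act_ge]). The Subword property puts
    every conjugate g^{-1} s1 g in the cone, hence forces g p <= s1 (g p) on the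
    whole orbit of p ([property_S_act_ge]). It is enough to find one action
    whose orbit of p has a point that s1 moves down.

    Since s2 p = p amounts to y r = x^{m-1} r with r = y^{-1} p, such an action
    is obtained on an archimedean field from x = translation by 1/m and
    y = translation by 1/n conjugated by an increasing bijection h that
    satisfies h (t + 1) = h t + 1, fixes 0 and sends 1/n to (m-1)/m. Both x^m
    and y^n are then translation by 1, and r = 0 gives p = (m-1)/m.

    The bad conjugator is g = x^{-1}. As p is congruent to -1/m modulo 1,
      x s1 x^{-1} p = x^2 y (-1/m) = x^2 y^2 (0) - 1 = h (2/n) - 1 + 2/m,
    where h (2/n) is 1 if n = 2 and less than 1 otherwise. This is less than
    p = 1 - 1/m exactly when 3/m + h (2/n) < 2, which holds if m >= 4, and also
    if m = n = 3 ([rot_bent_rot_lt]). *)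

(** * An increasing bijection of the line that commutes with t |-> t + 1 *)

Section Bend.
Import Order.TTheory GRing.Theory Num.Theory.
Local Open Scope ring_scope.
Variable R : archiRealFieldType.

(** The projective map that fixes 0 and 1 and has derivative a at 0. Any
    increasing bijection of [0, 1] with a prescribed value at 1/n would do;
    this family has closed-form inverses, the parameter becoming a^{-1}. *)
Definition mobius (a f : R) : R := a * f / (1 + (a - 1) * f).

Lemma mobius_den_gt0 (a f : R) : 0 < a -> 0 <= f < 1 -> 0 < 1 + (a - 1) * f.
Proof.
move=> a0 /andP[f0 f1]; have := mulr_ge0 (ltW a0) f0; lra.
Qed.

Lemma mobius_itv (a f : R) : 0 < a -> 0 <= f < 1 -> 0 <= mobius a f < 1.
Proof.
move=> a0 fI; have d0 := mobius_den_gt0 a0 fI; case/andP: fI => f0 f1.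
apply/andP; split; first by rewrite divr_ge0 ?mulr_ge0 // ltW.
by rewrite ltr_pdivrMr // mul1r; lra.
Qed.

Lemma mobius_lt (a f g : R) :
  0 < a -> 0 <= f < 1 -> 0 <= g < 1 -> f < g -> mobius a f < mobius a g.
Proof.
move=> a0 fI gI fg.
have df := mobius_den_gt0 a0 fI; have dg := mobius_den_gt0 a0 gI.
rewrite /mobius ltr_pdivrMr // mulrAC ltr_pdivlMr //.
have : 0 < a * (g - f) by rewrite mulr_gt0 // subr_gt0.
lra.
Qed.

Lemma mobiusK (a f : R) : 0 < a -> 0 <= f < 1 -> mobius a (mobius a^-1 f) = f.
Proof.
move=> a0 fI; have b0 : 0 < a^-1 by rewrite invr_gt0.
have d0 := mobius_den_gt0 b0 fI; set d := 1 + _ in d0.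
have aN0 : a != 0 by rewrite gt_eqF.
have dN0 : d != 0 by rewrite gt_eqF.
(* Inverse projective maps have inverse denominators. *)
have e : 1 + (a - 1) * mobius a^-1 f = d^-1.
  apply: (mulIf dN0); rewrite mulVf // mulrDl mul1r /mobius -/d.
  by rewrite -!mulrA mulVf // mulr1 /d; field.
by rewrite {1}/mobius e invrK /mobius -/d; field; rewrite dN0.
Qed.

Definition bend (a t : R) : R :=
  let k := (Num.floor t)%:~R in k + mobius a (t - k).

Lemma frac_itv (t : R) : 0 <= t - (Num.floor t)%:~R < 1.
Proof.
have := floor_le t; have := floorD1_gt t; rewrite intrD => h1 h2.
by rewrite subr_ge0 h2 ltrBlDl.
Qed.

Lemma bend_int (a : R) (k : int) (f : R) :
  0 <= f < 1 -> bend a (k%:~R + f) = k%:~R + mobius a f.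
Proof.
move=> /andP[f0 f1]; have fl : Num.floor (k%:~R + f) = k.
  by apply: floor_def; rewrite intrD lerDl ltrD2l f0.
by rewrite /bend fl (addrC k%:~R f) addrK.
Qed.

Lemma bendD1 (a t : R) : bend a (t + 1) = bend a t + 1.
Proof.
rewrite /bend floorDrz ?rpred1 // floor1 intrD.
by rewrite opprD addrACA subrr addr0 addrAC.
Qed.

Lemma bend_lt (a : R) : 0 < a -> {homo bend a : s t / s < t}.
Proof.
move=> a0 s t st; rewrite /bend.
have fs := frac_itv s; have ft := frac_itv t.
have := mobius_itv a0 fs; have := mobius_itv a0 ft.
have : Num.floor s <= Num.floor t by apply/le_floor/ltW.
rewrite le_eqVlt => /orP[/eqP e | lt_floor].
  by rewrite e => _ _; rewrite ltrD2l mobius_lt -?e // ?e ?ltrD2r.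
have : (Num.floor s)%:~R + 1 <= (Num.floor t)%:~R :> R.
  by rewrite -(intrD _ _ 1) ler_int lezD1.
lra.
Qed.

Lemma bendK (a : R) : 0 < a -> cancel (bend a^-1) (bend a).
Proof.
move=> a0 t; have b0 : 0 < a^-1 by rewrite invr_gt0.
rewrite {2}/bend /= bend_int ?mobius_itv ?frac_itv // mobiusK ?frac_itv //.
by rewrite addrC subrK.
Qed.

Lemma bendVK (a : R) : 0 < a -> cancel (bend a) (bend a^-1).
Proof. by move=> a0; rewrite -{1}[a]invrK; apply: bendK; rewrite invr_gt0. Qed.

Lemma bend0 (a : R) : bend a 0 = 0.
Proof. by rewrite /bend floor0 subrr /mobius mulr0 mul0r addr0. Qed.

End Bend.

(** * Actions of G_{m,n} on a partially ordered set *)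

Section Action.
Import Order.TTheory.
Variables (m n : nat) (disp : Order.disp_t) (T : porderType disp).
Variables (X X' Y Y' : T -> T).
Hypotheses (XK : cancel X X') (X'K : cancel X' X).
Hypotheses (YK : cancel Y Y') (Y'K : cancel Y' Y).
Hypothesis XY : iter m X =1 iter n Y.
Local Open Scope group_scope.
Local Notation G := (Gmn m n).

Definition letter_act (l : letter) : T -> T :=
  match l with
  | (false, false) => X | (false, true) => X'
  | (true, false) => Y | (true, true) => Y'
  end.

Definition word_act (w : word) (t : T) : T := foldr letter_act t w.

Lemma word_act_cat u v t : word_act (u ++ v) t = word_act u (word_act v t).
Proof. exact: foldr_cat. Qed.

Lemma pres_eq_act u v : pres_eq m n u v -> word_act u =1 word_act v.
Proof.
have iterE k l t : word_act (nseq k l) t = iter k (letter_act l) t.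
  by elim: k => //= k ->.
elim=> {u v} [u|u v _ IH|u v w _ IH1 _ IH2|u u' v v' _ IH1 _ IH2|[[] []]|] t //=.
- by rewrite IH1 IH2.
- by rewrite !word_act_cat IH2 IH1.
- by rewrite !iterE XY.
Qed.

(** Word actions descend to the group because the presentation only cancels
    letters and exchanges x^m with y^n, hence the choice of the representative
    does not matter. *)
Definition Gmn_act (g : G) : T -> T := word_act (repr g).

Lemma Gmn_act_class w t : Gmn_act (Gmn_class m n w) t = word_act w t.
Proof. exact/pres_eq_act/pres_eq_repr. Qed.

Lemma Gmn_act1 t : Gmn_act 1 t = t.
Proof. exact: Gmn_act_class. Qed.

Lemma Gmn_actM (g h : G) t : Gmn_act (g * h) t = Gmn_act g (Gmn_act h t).
Proof. by rewrite [LHS]Gmn_act_class word_act_cat. Qed.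

Lemma Gmn_actK (g : G) : cancel (Gmn_act g) (Gmn_act g^-1).
Proof. by move=> t; rewrite -Gmn_actM mulVg Gmn_act1. Qed.

Lemma Gmn_actVK (g : G) : cancel (Gmn_act g^-1) (Gmn_act g).
Proof. by move=> t; rewrite -Gmn_actM mulgV Gmn_act1. Qed.

Lemma Gmn_actX (g : G) k t : Gmn_act (g ^+ k) t = iter k (Gmn_act g) t.
Proof.
by elim: k => [|k IHk]; rewrite ?expg0 ?Gmn_act1 // expgS Gmn_actM IHk.
Qed.

Lemma Gmn_act_x t : Gmn_act (gen_x m n) t = X t.
Proof. exact: Gmn_act_class. Qed.

Lemma Gmn_act_y t : Gmn_act (gen_y m n) t = Y t.
Proof. exact: Gmn_act_class. Qed.

Lemma Gmn_act_xV t : Gmn_act (gen_x m n)^-1 t = X' t.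
Proof.
by apply: (can_inj (Gmn_actK (gen_x m n))); rewrite Gmn_actVK Gmn_act_x X'K.
Qed.

Lemma Gmn_act_yV t : Gmn_act (gen_y m n)^-1 t = Y' t.
Proof.
by apply: (can_inj (Gmn_actK (gen_y m n))); rewrite Gmn_actVK Gmn_act_y Y'K.
Qed.

Lemma Gmn_act_s1 t : Gmn_act (gen_s1 m n) t = X (Y (iter (m - 1) X' t)).
Proof.
rewrite /gen_s1 -expVgn !Gmn_actM Gmn_act_x Gmn_act_y Gmn_actX.
by rewrite (eq_iter Gmn_act_xV).
Qed.

Lemma Gmn_act_s2 t : Gmn_act (gen_s2 m n) t = iter (m - 1) X (Y' t).
Proof. by rewrite Gmn_actM Gmn_actX Gmn_act_yV (eq_iter Gmn_act_x). Qed.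

Hypotheses (X_le : {homo X : s t / (s <= t)%O}).
Hypotheses (X'_le : {homo X' : s t / (s <= t)%O}).
Hypotheses (Y_le : {homo Y : s t / (s <= t)%O}).
Hypotheses (Y'_le : {homo Y' : s t / (s <= t)%O}).

Lemma Gmn_act_le (g : G) : {homo Gmn_act g : s t / (s <= t)%O}.
Proof.
move=> s t st; rewrite /Gmn_act; elim: (repr g) => //= [[[] []] w] IH /=.
- exact: Y'_le.
- exact: Y_le.
- exact: X'_le.
- exact: X_le.
Qed.

(** The letters s2 and s2^{-1} fix p and s1 pushes it up; as all of them
    preserve the order, the set of points above p is stable under each, and so
    under every word that avoids s1^{-1}. *)
Lemma dehornoy_cone_act_ge (p : T) (g : G) :
    Gmn_act (gen_s2 m n) p = p -> (p <= Gmn_act (gen_s1 m n) p)%O ->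
  dehornoy_cone g -> (p <= Gmn_act g p)%O.
Proof.
move=> s2p s1p [[w [_ w_pos ->]]|[k [_ ->]]]; last first.
  rewrite Gmn_actX; elim: k => //= k IHk.
  by rewrite -{1}s2p Gmn_act_le.
elim: w w_pos => [|l w IHw]; first by rewrite /word_val big_nil Gmn_act1.
rewrite inE negb_or /word_val big_cons Gmn_actM => /andP[l_pos /IHw p_le].
case: l l_pos => [[] []] // _; rewrite /letter_val /=.
- have {1}-> : p = Gmn_act (gen_s2 m n)^-1 p by rewrite -[in RHS]s2p Gmn_actK.
  exact: Gmn_act_le.
- by rewrite -{1}s2p; apply: Gmn_act_le.
- by apply: le_trans s1p _; apply: Gmn_act_le.
Qed.

(** The relation g <_D s1 g says that g^{-1} s1 g lies in the cone; the
    inequality at p that follows is transported by g. *)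
Lemma property_S_act_ge (p : T) :
    Gmn_act (gen_s2 m n) p = p -> (p <= Gmn_act (gen_s1 m n) p)%O ->
    property_S (@dehornoy_lt m n) -> forall g : G,
  (Gmn_act g p <= Gmn_act (gen_s1 m n) (Gmn_act g p))%O.
Proof.
move=> s2p s1p propS g.
have s1_pos : S_word_positive (gen_s1 m n).
  by exists [:: (false, false)]; split=> //; rewrite /word_val big_seq1.
have /(dehornoy_cone_act_ge s2p s1p) := propS g _ s1_pos.
by move/(Gmn_act_le g); rewrite !Gmn_actM Gmn_actVK.
Qed.

End Action.

(** * An action in which a conjugate of s1 moves the base point down *)

Section Realization.
Import Order.TTheory GRing.Theory Num.Theory.
Local Open Scope ring_scope.
Variables (R : archiRealFieldType) (m n : nat).
Hypotheses (m_gt1 : (1 < m)%N) (n_gt1 : (1 < n)%N).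

(* With this parameter, bend a sends 1/n to (m-1)/m. *)
Let a : R := (m.-1 * n.-1)%N%:R.

Let a_gt0 : 0 < a.
Proof. by rewrite ltr0n; case: m n m_gt1 n_gt1 => [|[]] // ? [|[]]. Qed.

Definition rot (k : nat) (t : R) : R := t + k%:R^-1.
Definition rotV (k : nat) (t : R) : R := t - k%:R^-1.
Definition bent_rot (t : R) : R := bend a (rot n (bend a^-1 t)).
Definition bent_rotV (t : R) : R := bend a (rotV n (bend a^-1 t)).

Lemma rotK k : cancel (rot k) (rotV k).
Proof. exact: addrK. Qed.

Lemma rotVK k : cancel (rotV k) (rot k).
Proof. exact: subrK. Qed.

Lemma rot_le k : {homo rot k : s t / s <= t}.
Proof. by move=> s t; rewrite lerD2r. Qed.

Lemma rotV_le k : {homo rotV k : s t / s <= t}.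
Proof. by move=> s t; rewrite lerD2r. Qed.

Lemma iter_rot k j t : iter j (rot k) t = t + j%:R / k%:R.
Proof.
elim: j => [|j IHj] /=; first by rewrite mul0r addr0.
by rewrite IHj /rot -addrA -[in RHS]natr1 mulrDl mul1r.
Qed.

Lemma iter_rotV k j t : iter j (rotV k) t = t - j%:R / k%:R.
Proof.
elim: j => [|j IHj] /=; first by rewrite mul0r subr0.
by rewrite IHj /rotV -addrA -opprD -[in RHS]natr1 mulrDl mul1r.
Qed.

Lemma iter_bent_rot j t :
  iter j bent_rot t = bend a (iter j (rot n) (bend a^-1 t)).
Proof. by elim: j => [|j IHj] /=; rewrite ?IHj /bent_rot ?bendVK ?bendK. Qed.

Lemma bent_rotK : cancel bent_rot bent_rotV.
Proof. by move=> t; rewrite /bent_rotV /bent_rot bendVK // rotK bendK. Qed.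

Lemma bent_rotVK : cancel bent_rotV bent_rot.
Proof. by move=> t; rewrite /bent_rotV /bent_rot bendVK // rotVK bendK. Qed.

Lemma bend_le (b : R) : 0 < b -> {homo bend b : s t / s <= t}.
Proof. by move=> b_gt0; apply/ltW_homo/bend_lt. Qed.

Lemma bent_rot_le : {homo bent_rot : s t / s <= t}.
Proof. by move=> s t st; rewrite !(bend_le, rot_le) ?invr_gt0. Qed.

Lemma bent_rotV_le : {homo bent_rotV : s t / s <= t}.
Proof. by move=> s t st; rewrite !(bend_le, rotV_le) ?invr_gt0. Qed.

Lemma rot_bent_rot : iter m (rot m) =1 iter n bent_rot.
Proof.
move=> t; rewrite iter_bent_rot !iter_rot !divff ?pnatr_eq0 -?lt0n 1?ltnW //.
by rewrite bendD1 bendK.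
Qed.

(** This value determines the parameter a: it gives y 0 = x^{m-1} 0, so that
    s2 = x^{m-1} y^{-1} fixes x^{m-1} 0 = 1 - 1/m. *)
Lemma bent_rot0 : bent_rot 0 = 1 - m%:R^-1.
Proof.
have m0 : (m%:R != 0 :> R) by rewrite pnatr_eq0 -lt0n ltnW.
have n0 : (n%:R != 0 :> R) by rewrite pnatr_eq0 -lt0n ltnW.
rewrite /bent_rot bend0 /rot add0r -[n%:R^-1]add0r (bend_int _ 0); last first.
  by rewrite invr_ge0 ler0n invf_lt1 ?ltr1n ?ltr0n // ltnW.
have n1 : n%:R - 1 != 0 :> R by rewrite subr_eq0 pnatr_eq1 gtn_eqF.
have aE : a = (m%:R - 1) * (n%:R - 1).
  by rewrite /a natrM -!subn1 !natrB // ltnW.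
have e : 1 + (a - 1) * n%:R^-1 = m%:R * (n%:R - 1) / n%:R by rewrite aE; field.
by rewrite add0r /mobius e aE; field; rewrite m0 n0 n1.
Qed.

Lemma bent_rotD1 t : bent_rot (t + 1) = bent_rot t + 1.
Proof.
have bendV := bendD1 a^-1 t.
by rewrite /bent_rot bendV /rot addrAC bendD1.
Qed.

Lemma bent_rotNVm : bent_rot (- m%:R^-1) = bend a (2 / n%:R) - 1.
Proof.
have -> : bend a (2 / n%:R) = bent_rot (bent_rot 0).
  rewrite -[RHS]/(iter 2 bent_rot 0) iter_bent_rot iter_rot.
  by rewrite -[in RHS](bend0 a) bendVK // add0r.
by rewrite bent_rot0 [1 - _]addrC bent_rotD1 addrK.
Qed.

(** The left-hand side equals bend a (2/n) - 1 + 1/m. If n > 2 then 2/n < 1 and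
    m >= 3 suffices; if n = 2 then bend a 1 = 1 and the inequality reads
    3/m < 1, which fails precisely for the braid group, m = 3, and for m = 2. *)
Lemma rot_bent_rot_lt :
    (n <= m)%N -> (m, n) <> (2, 2)%N -> (m, n) <> (3, 2)%N ->
  rot m (bent_rot (- m%:R^-1)) < 1 - m%:R^-1 - m%:R^-1.
Proof.
move=> nm h22 h32.
have m0 : 0 < m%:R :> R by rewrite ltr0n ltnW.
have n0 : 0 < n%:R :> R by rewrite ltr0n ltnW.
have bend1 : bend a 1 = 1 by rewrite -[in LHS](add0r 1) bendD1 bend0 add0r.
have m3 : (2 < m)%N by case: m n m_gt1 n_gt1 nm h22 => [|[|[|?]]] // [|[|[|?]]].
have le3m : 3 / m%:R <= 1 :> R by rewrite ler_pdivrMr // mul1r ler_nat.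
have twoE : 2 / m%:R + m%:R^-1 = 3 / m%:R :> R by field; rewrite gt_eqF.
rewrite bent_rotNVm /rot.
have [n3|n2] := ltnP 2 n.
  have : bend a (2 / n%:R) < 1.
    by rewrite -[X in _ < X]bend1 bend_lt // ltr_pdivrMr // mul1r ltr_nat.
  lra.
have nE : n = 2 by apply/eqP; rewrite eqn_leq n2.
have m4 : (3 < m)%N.
  by rewrite ltn_neqAle m3 andbT; apply/eqP=> e; apply: h32; rewrite -e nE.
have : 3 / m%:R < 1 :> R by rewrite ltr_pdivrMr // mul1r ltr_nat.
rewrite nE divff ?pnatr_eq0 // bend1; lra.
Qed.

(** The orbit point x^{-1} p with p = 1 - 1/m contradicts
    [property_S_act_ge]: s1 sends it to x y (p - 1), which lies below it. *)
Lemma not_property_S : (n <= m)%N -> (m, n) <> (2, 2)%N ->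
  (m, n) <> (3, 2)%N -> ~ property_S (@dehornoy_lt m n).
Proof.
move=> nm h22 h32 propS.
have m0 : (m%:R != 0 :> R) by rewrite pnatr_eq0 -lt0n ltnW.
have predE : (m - 1)%:R / m%:R = 1 - m%:R^-1 :> R.
  by rewrite natrB ?(ltnW m_gt1) // mulrBl divff // mul1r.
pose act := @Gmn_act m n _ R (rot m) (rotV m) bent_rot bent_rotV.
have actX := rotK m; have actXV := rotVK m.
have actY := bent_rotK; have actYV := bent_rotVK.
have act_rel := rot_bent_rot.
pose p : R := 1 - m%:R^-1.
have s2p : act (gen_s2 m n) p = p.
  rewrite /act Gmn_act_s2 // /p -bent_rot0 bent_rotK.
  by rewrite iter_rot add0r predE bent_rot0.
have s1p : p <= act (gen_s1 m n) p.
  rewrite /act Gmn_act_s1 // iter_rotV predE /p subrr bent_rot0.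
  by rewrite lerDl invr_ge0 ler0n.
have := property_S_act_ge actX actXV actY actYV act_rel
  (@rot_le m) (@rotV_le m) bent_rot_le bent_rotV_le s2p s1p propS
  (gen_x m n)^-1%g.
have e : p - m%:R^-1 - p = - m%:R^-1 by rewrite addrAC subrr add0r.
rewrite Gmn_act_s1 // Gmn_act_xV // iter_rotV /rotV predE e leNgt.
by rewrite rot_bent_rot_lt.
Qed.

End Realization.

Theorem theorem6 (m n : nat) (hn : (2 <= n)%N) (hmn : (n <= m)%N)
    (h22 : (m, n) <> (2, 2)) (h32 : (m, n) <> (3, 2)) :
  ~ property_S (@dehornoy_lt m n).
Proof.
exact: (@not_property_S rat m n (leq_trans hn hmn) hn hmn h22 h32).
Qed.
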